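(* Let $n>2$ and $\xi\in[0,\xi_c]$, where $\xi_c=\frac{n-2}{4(n-1)}$. Suppose $(M,g,\phi)$ is a solution to the Einstein–Klein–Gordon equation in dimension $n$ with coupling constant $\xi$, and that $|\phi|<(8\pi\xi)^{-1/2}$ on $M$ (no condition if $\xi=0$). Let $\gamma$ be a timelike geodesic in $(M,g)$ parametrized by proper time $\tau$, defined on an open interval $I\subseteq\mathbb{R}$, and let $f\in C^2_0(\mathbb{R})$ be real-valued with compact support contained in $I$. Then $$\int_\gamma d\tau\,R_{\mu\nu}\dot\gamma^\mu\dot\gamma^\nu f^2(\tau)\ \le\ \int_\gamma d\tau\,\Big\{\Big(\frac{1-2\xi}{n-2}\Big)\frac{m^2f^2(\tau)}{1-8\pi\xi\phi^2}+2\xi\Big(\frac{d}{d\tau}\frac{f(\tau)}{\sqrt{1-8\pi\xi\phi^2}}\Big)^2\Big\}\,8\pi\phi^2 ,$$ where $\phi$ and $R_{\mu\nu}$ are evaluated along $\gamma$.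
   Context: Conventions: the metric $g$ is smooth and Lorentzian with signature $(+,-,\dots,-)$; the sign conventions are $[-,-,-]$ of Misner–Thorne–Wheeler, so $R_{\mu\nu}$ is minus the usual Ricci tensor (the usual one, $\mathrm{Ric}$, satisfies $(\nabla_\nu\nabla_\mu-\nabla_\mu\nabla_\nu)V^\nu=\mathrm{Ric}_{\mu\sigma}V^\sigma$), i.e. $R_{\mu\nu}=-\mathrm{Ric}_{\mu\nu}$. The Ricci scalar is $R=g^{\mu\nu}R_{\mu\nu}$, the Einstein tensor is $G_{\mu\nu}=R_{\mu\nu}-\tfrac12 R g_{\mu\nu}$, and $\Box_g=g^{\mu\nu}\nabla_\mu\nabla_\nu$. The mass $m\ge 0$ is a constant. Units are $G=c=1$. A solution $(M,g,\phi)$ to the Einstein–Klein–Gordon equation with coupling constant $\xi$ consists of a spacetime $(M,g)$ and a smooth real-valued function $\phi$ on $M$ satisfying both the field equation $(\Box_g+m^2+\xi R)\phi=0$ and the Einstein equation $G_{\mu\nu}=-8\pi T_{\mu\nu}$, where $$T_{\mu\nu}=(\nabla_\mu\phi)(\nabla_\nu\phi)+\tfrac12 g_{\mu\nu}\big(m^2\phi^2-(\nabla\phi)^2\big)+\xi\,(g_{\mu\nu}\Box_g-\nabla_\mu\nabla_\nu-G_{\mu\nu})\phi^2 ,$$ with $(\nabla\phi)^2=g^{\mu\nu}(\nabla_\mu\phi)(\nabla_\nu\phi)$ and the differential operators acting on $\phi^2$. *)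

(* Defs.v *)
From HB Require Import structures.
From mathcomp Require Import all_boot all_order all_algebra.
From mathcomp Require Import all_classical all_reals all_analysis.

Set Implicit Arguments.
Unset Strict Implicit.
Unset Printing Implicit Defensive.

Import Order.TTheory GRing.Theory Num.Theory.
Import numFieldNormedType.Exports.

Local Open Scope classical_set_scope.
Local Open Scope ring_scope.

(** C^k maps. The definition is meant for open [U] and finite-dimensional [V];
    functions on the line take [V := R^o]. *)
Fixpoint Ck (R : realType) (V W : normedModType R) (k : nat) (U : set V)
    (f : V -> W) : Prop :=
  match k with
  | 0%N => {in U, continuous f}
  | k'.+1 => (forall x, U x -> differentiable f x) /\
             (forall v : V, Ck k' U (fun x => 'D_v f x))
  end.

Definition smooth_on (R : realType) (V W : normedModType R) (U : set V)
    (f : V -> W) : Prop :=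
  forall k, Ck k U f.

(** Charts are total functions in both directions; their values outside
    [chart_dom], resp. outside the image of [chart_dom], are irrelevant. *)
Record chart (R : realType) (n : nat) (M : topologicalType) := Chart {
  chart_dom : set M;
  coord : M -> 'rV[R]_n;
  coord_inv : 'rV[R]_n -> M;
  chart_dom_open : open chart_dom;
  chart_img_open : open (coord @` chart_dom);
  coordK : forall p, chart_dom p -> coord_inv (coord p) = p;
  coord_continuous : {in chart_dom, continuous coord};
  coord_inv_continuous : {in coord @` chart_dom, continuous coord_inv}
}.

Definition chart_img (R : realType) (n : nat) (M : topologicalType)
    (c : chart R n M) : set 'rV[R]_n :=
  coord c @` chart_dom c.

Definition transition (R : realType) (n : nat) (M : topologicalType)
    (c d : chart R n M) : 'rV[R]_n -> 'rV[R]_n :=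
  coord d \o coord_inv c.

(** [chart_at] singles out a chart around each point. It serves only to
    evaluate chart-independent quantities. *)
Record smooth_manifold (R : realType) (n : nat) (M : topologicalType) :=
  SmoothManifold {
  manifold_hausdorff : hausdorff_space M;
  manifold_second_countable : @second_countable M;
  atlas : set (chart R n M);
  atlas_compatible : forall c d, atlas c -> atlas d ->
    smooth_on (coord c @` (chart_dom c `&` chart_dom d)) (transition c d);
  chart_at : M -> chart R n M;
  chart_at_atlas : forall p, atlas (chart_at p);
  chart_at_dom : forall p, chart_dom (chart_at p) p
}.

Section local_geometry.
Context {R : realType} {n : nat}.
Implicit Types (g : 'rV[R]_n -> 'M[R]_n) (u : 'rV[R]_n -> R) (x : 'rV[R]_n).
Implicit Types (i j k l : 'I_n).

Definition partial i u x : R := 'D_(delta_mx 0 i : 'rV[R]_n) u x.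

Definition quad (A : 'M[R]_n) (v : 'rV[R]_n) : R :=
  \sum_i \sum_j A i j * v 0 i * v 0 j.

(** Signature (+,-,...,-); symmetry of [A] follows. *)
Definition lorentzian (A : 'M[R]_n) : Prop :=
  exists2 P : 'M[R]_n, P \in unitmx &
    P *m A *m P^T =
      diag_mx (\row_(i < n) (if (i : nat) == 0%N then 1 else -1)).

Definition metric_inv g x : 'M[R]_n := invmx (g x).

(** Gamma^l_{i j} *)
Definition christoffel g l i j x : R :=
  2^-1 * \sum_k metric_inv g x l k *
    (partial i (fun y => g y k j) x + partial j (fun y => g y k i) x
     - partial k (fun y => g y i j) x).

(** The usual Riemann tensor Riem^l_{k i j}, for which
    (nabla_i nabla_j - nabla_j nabla_i) V^l = Riem^l_{k i j} V^k. *)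
Definition riemann g l k i j x : R :=
  partial i (christoffel g l j k) x - partial j (christoffel g l i k) x
  + \sum_(s < n) (christoffel g l i s x * christoffel g s j k x
                  - christoffel g l j s x * christoffel g s i k x).

(** In the [-,-,-] convention R_{ij} is minus the usual Ricci tensor
    Riem^l_{i l j}. *)
Definition ricci g x : 'M[R]_n :=
  \matrix_(i, j) - \sum_l riemann g l i l j x.

Definition scalar_curvature g x : R :=
  \sum_i \sum_j metric_inv g x i j * ricci g x i j.

Definition einstein g x : 'M[R]_n :=
  ricci g x - (2^-1 * scalar_curvature g x) *: g x.

(** nabla_i nabla_j u *)
Definition hessian g u i j x : R :=
  partial i (partial j u) x - \sum_k christoffel g k i j x * partial k u x.

Definition box g u x : R :=
  \sum_i \sum_j metric_inv g x i j * hessian g u i j x.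

Definition grad_sq g u x : R :=
  \sum_i \sum_j metric_inv g x i j * partial i u x * partial j u x.

Definition stress_energy (m xi : R) g u x : 'M[R]_n :=
  let u2 := fun y => u y ^+ 2 in
  \matrix_(i, j)
    (partial i u x * partial j u x
     + 2^-1 * g x i j * (m ^+ 2 * u x ^+ 2 - grad_sq g u x)
     + xi * (g x i j * box g u2 x - hessian g u2 i j x
             - einstein g x i j * u2 x)).

End local_geometry.

Definition smooth_function (R : realType) (n : nat) (M : topologicalType)
    (A : smooth_manifold R n M) (phi : M -> R) : Prop :=
  forall c, atlas A c ->
    smooth_on (chart_img c) (phi \o coord_inv c : 'rV[R]_n -> R^o).

(** A metric is given by its components in every chart of the atlas, subject to
    the transformation law of a covariant 2-tensor. The library Jacobian acts on
    row vectors: entry (i, k) of ['J y x] is the partial derivative of y^k along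
    x^i. *)
Record lorentz_metric (R : realType) (n : nat) (M : topologicalType)
    (A : smooth_manifold R n M) := LorentzMetric {
  metric_comp :> chart R n M -> 'rV[R]_n -> 'M[R]_n;
  metric_smooth : forall c, atlas A c -> forall i j : 'I_n,
    smooth_on (chart_img c) (fun x => metric_comp c x i j : R^o);
  metric_lorentzian : forall c, atlas A c -> forall x, chart_img c x ->
    lorentzian (metric_comp c x);
  metric_tensorial : forall c d, atlas A c -> atlas A d ->
    forall p, chart_dom c p -> chart_dom d p ->
    let J := jacobian (transition c d) (coord c p) in
    metric_comp c (coord c p) = J *m metric_comp d (coord d p) *m J^T
}.

Section spacetime.
Context {R : realType} {n : nat} {M : topologicalType}.
Context {A : smooth_manifold R n M}.
Implicit Types (g : lorentz_metric A) (c : chart R n M).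

Record ekg_solution (m xi : R) g (phi : M -> R) : Prop := EKGSolution {
  ekg_smooth : smooth_function A phi;
  ekg_field_eq : forall c, atlas A c -> forall x, chart_img c x ->
    let u := phi \o coord_inv c in
    box (g c) u x + m ^+ 2 * u x + xi * scalar_curvature (g c) x * u x = 0;
  ekg_einstein_eq : forall c, atlas A c -> forall x, chart_img c x ->
    einstein (g c) x =
      - (8 * pi) *: stress_energy m xi (g c) (phi \o coord_inv c) x
}.

Definition velocity c (gamma : R -> M) (t : R) : 'rV[R]_n :=
  derive1 (coord c \o gamma) t.

Definition acceleration c (gamma : R -> M) (t : R) : 'rV[R]_n :=
  derive1 (velocity c gamma) t.

(** Timelike geodesics parametrized by proper time; only the values of [gamma]
    on the open interval [I] matter. *)
Record timelike_geodesic g (I : set R) (gamma : R -> M) : Prop :=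
  TimelikeGeodesic {
  geodesic_continuous : {in I, continuous gamma};
  geodesic_smooth : forall c, atlas A c ->
    smooth_on [set t : R^o | I t /\ chart_dom c (gamma t)] (coord c \o gamma);
  geodesic_eq : forall c, atlas A c ->
    forall t, I t -> chart_dom c (gamma t) -> forall l : 'I_n,
    acceleration c gamma t 0 l
    + \sum_i \sum_j christoffel (g c) l i j (coord c (gamma t))
        * velocity c gamma t 0 i * velocity c gamma t 0 j = 0;
  geodesic_unit : forall c, atlas A c ->
    forall t, I t -> chart_dom c (gamma t) ->
    quad (g c (coord c (gamma t))) (velocity c gamma t) = 1
}.

(** R_{ij} gamma'^i gamma'^j at parameter value [t] *)
Definition ricci_along g (gamma : R -> M) (t : R) : R :=
  let c := chart_at A (gamma t) in
  quad (ricci (g c) (coord c (gamma t))) (velocity c gamma t).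

End spacetime.

Definition conformal_coupling (R : realType) (n : nat) : R :=
  (n%:R - 2) / (4 * (n%:R - 1)).

(* Main.v *)
(** Write [F = 1 - 8 pi xi phi^2], [k = 8 pi] and let [v] be the velocity of the
    geodesic. Contracting the Einstein equation with [v] and with the inverse
    metric, and eliminating [R] and [box phi] by means of the field equation,
    expresses [F Rvv], where [Rvv = R_{ij} v^i v^j], through [phi], [d phi(v)],
    [phi] Hess [phi(v, v)] and [(grad phi)^2]. Since [v] is unit timelike,
    [(grad phi)^2 <= d phi(v)^2]; for [0 <= xi <= xi_c] the signs of the
    coefficients then give, with [q = phi o gamma] and hence
    [q'' =] Hess [phi(v, v)],
      [F Rvv <= k ((1 - 2 xi) / (n - 2) m^2 q^2 + 2 xi q q'')].
    Multiply by [h^2], [h = f / sqrt F]: the identity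
      [h^2 q q'' = (h^2 q q')' - (h q' + h' q)^2 + (h' q)^2]
    bounds the integrand by the one on the right of the theorem plus the
    derivative of a compactly supported function. *)

Require Import Defs.
From HB Require Import structures.
From mathcomp Require Import all_boot all_order all_algebra.
From mathcomp Require Import ring lra.
From mathcomp Require Import all_classical all_reals all_analysis.
From mathcomp Require Import measurable_realfun.

Set Implicit Arguments.
Unset Strict Implicit.
Unset Printing Implicit Defensive.

Import Order.TTheory GRing.Theory Num.Theory.
Import numFieldNormedType.Exports.

Local Open Scope classical_set_scope.
Local Open Scope ring_scope.

(** * The algebra of the contracted field equations at one point *)

(* [p] is the value of phi, [pv2 = (d phi(v))^2], [gs = (grad phi)^2],
   [H] = Hess [phi^2 (v, v)], [bx = box phi], [Rvv = R_{ij} v^i v^j] and [Rs] the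
   scalar curvature. The equations are the Einstein equation contracted with [v]
   and with the inverse metric, and the field equation. *)
Lemma ekg_convergence_bound (R : realFieldType)
    (N k m xi p Rvv Rs pv2 gs H bx : R) :
  2 < N -> 0 <= k -> 0 <= xi -> xi <= (N - 2) / (4 * (N - 1)) ->
  0 < 1 - k * xi * p ^+ 2 -> gs <= pv2 -> 0 <= pv2 ->
  Rvv - 2^-1 * Rs = - k * (pv2 + 2^-1 * (m ^+ 2 * p ^+ 2 - gs)
    + xi * (2 * p * bx + 2 * gs - H - (Rvv - 2^-1 * Rs) * p ^+ 2)) ->
  Rs - 2^-1 * N * Rs = - k * (gs + 2^-1 * N * (m ^+ 2 * p ^+ 2 - gs)
    + xi * (N * (2 * p * bx + 2 * gs) - (2 * p * bx + 2 * gs)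
            - (Rs - 2^-1 * N * Rs) * p ^+ 2)) ->
  bx + m ^+ 2 * p + xi * Rs * p = 0 ->
  (1 - k * xi * p ^+ 2) * Rvv <=
    k * ((1 - 2 * xi) / (N - 2) * (m ^+ 2 * p ^+ 2) - 2 * xi * pv2 + xi * H).
Proof.
move=> N2 k0 xi0 xic F0 gspv pv0 Evv Etr Efe.
(* [D = (N - 2) (1 - s (1 - xi / xi_c))] *)
set s := k * xi * p ^+ 2 in F0 *; pose c := N - 2; pose M := m ^+ 2 * p ^+ 2.
pose y := 4 * (N - 1) * xi; pose D := c - s * (c - y).
have c0 : 0 < c by rewrite /c; lra.
have M0 : 0 <= M by rewrite mulr_ge0// sqr_ge0.
have s0 : 0 <= s by rewrite mulr_ge0 ?sqr_ge0// mulr_ge0.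
(* Since [y = c xi / xi_c], the range of the coupling becomes [0 <= y <= c]. *)
have yc : y <= c.
  move: xic; rewrite ler_pdivlMr; last by lra.
  by rewrite /y /c; lra.
have y0 : 0 <= y by rewrite /y mulr_ge0// mulr_ge0//; lra.
(* [(N - 1) (1 - 2 xi) = N - 1 - y / 2], and [y <= N - 2]. *)
have xi1 : 0 <= 1 - 2 * xi.
  have N10 : 0 < N - 1 by lra.
  by rewrite -(pmulr_rge0 _ N10); move: yc y0; rewrite /y /c; lra.
have Ebx : bx = - (m ^+ 2 * p + xi * Rs * p) by lra.
(* [D - y = (1 - s) (c - y)] here and [D = (1 - s) c + s y] next, with [0 < 1 - s]. *)
have yD : y <= D.
  have : 0 <= (1 - s) * (c - y) by rewrite mulr_ge0 ?subr_ge0//; lra.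
  by rewrite /D; lra.
have D0 : 0 < D.
  have : 0 < (1 - s) * c by rewrite mulr_gt0.
  have : 0 <= s * y by rewrite mulr_ge0.
  by rewrite /D; lra.
(* The trace equation, with [bx] eliminated, solved for the scalar curvature. *)
have ED : D * Rs = k * (- (c - y) * gs + (N - y) * M).
  move: Etr; rewrite Ebx /D /c /y /s /M; lra.
have EF : c * ((1 - s) * Rvv) =
    k * ((1 - 2 * xi) * M + c * (xi * H - pv2)
         + 2 * xi * (gs - xi * p ^+ 2 * Rs)).
  by move: Etr Evv; rewrite Ebx /c /s /M; nra.
(* This absorbs the last term of [EF]: the coefficient of [pv2] rises from [- c] to [- 2 xi c].
   After multiplication by [D], [ED] removes [Rs], the mass term has a favourable sign, and
   [gs <= pv2] leaves the scalar inequality [2 xi <= D (1 - 2 xi)]. *)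
have bound : 2 * xi * (gs - xi * p ^+ 2 * Rs) <= c * (1 - 2 * xi) * pv2.
  rewrite -(ler_pM2l D0).
  have -> : D * (2 * xi * (gs - xi * p ^+ 2 * Rs)) =
      2 * xi * (c * gs - s * (N - y) * M).
    transitivity (2 * xi * (D * gs - xi * p ^+ 2 * (D * Rs))); first by ring.
    by rewrite ED /D /s; ring.
  have : 0 <= 2 * xi * (s * (N - y) * M).
    have Ny : 0 <= N - y by move: yc; rewrite /c; lra.
    exact: mulr_ge0 (mulr_ge0 _ xi0) (mulr_ge0 (mulr_ge0 s0 Ny) M0).
  have : 0 <= 2 * xi * c * (pv2 - gs).
    by rewrite mulr_ge0 ?subr_ge0// mulr_ge0 ?(ltW c0)// mulr_ge0.
  (* [D (1 - 2 xi) >= y (1 - 2 xi) >= 2 xi]; the second inequality uses [y = 4 (N - 1) xi] and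
     [y <= c]. *)
  have : 0 <= (D - y) * (1 - 2 * xi).
    by rewrite mulr_ge0// subr_ge0.
  have : 0 <= xi * (4 * (N - 1) * (1 - 2 * xi) - 2).
    rewrite mulr_ge0//; move: yc; rewrite /y /c; lra.
  move=> h1 h2 h3 h4.
  have : 0 <= (D * (1 - 2 * xi) - 2 * xi) * (c * pv2).
    rewrite mulr_ge0//; first by move: h1 h2; rewrite /y; lra.
    by rewrite mulr_ge0// ltW.
  lra.
rewrite -(ler_pM2l c0) EF.
rewrite [X in _ <= X](_ : _ = k * ((1 - 2 * xi) * M - c * (2 * xi * pv2)
    + c * (xi * H))); last first.
  by rewrite /M /c; field; rewrite gt_eqF.
rewrite ler_wpM2l//; lra.
Qed.

(** * Lorentzian quadratic forms and the reverse Cauchy-Schwarz inequality *)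

Lemma quadE (R : realType) n (A : 'M[R]_n) (v : 'rV[R]_n) :
  quad A v = (v *m A *m v^T) 0 0.
Proof.
rewrite /quad mxE exchange_big; apply: eq_bigr => j _.
by rewrite mxE mulr_suml; apply: eq_bigr => i _; rewrite !mxE (mulrC (A i j)).
Qed.

Lemma quadM (R : realType) n (A P : 'M[R]_n) (v : 'rV[R]_n) :
  quad (P *m A *m P^T) v = quad A (v *m P).
Proof. by rewrite !quadE trmx_mul !mulmxA. Qed.

Definition minkowski_mx (R : realType) n : 'M[R]_n :=
  diag_mx (\row_(i < n) (if (i : nat) == 0%N then 1 else -1)).

(* With [a = a0 + a'] and [w = w0 + w'] split into time and space parts and
   [a0^2 = 1 + |a'|^2], the difference of the two sides times [a0^2] is
   [|a0 w' + w0 a'|^2 + (a0 <a', w'> + |a'|^2 w0)^2]. *)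
Lemma minkowski_le_sqr (R : realType) n (a w : 'rV[R]_n) :
  quad (minkowski_mx R n) a = 1 ->
  quad (minkowski_mx R n) w <= (\sum_i a 0 i * w 0 i) ^+ 2.
Proof.
case: n a w => [|n] a w.
  by rewrite /quad big_ord0 => /esym/eqP; rewrite oner_eq0.
have quad_eta v : quad (minkowski_mx R n.+1) v =
    v 0 0 ^+ 2 - \sum_(i < n) v 0 (lift ord0 i) ^+ 2.
  rewrite quadE mul_mx_diag mxE big_ord_recl !mxE eqxx mulr1 -expr2 -sumrN.
  congr +%R; apply: eq_bigr => i _; rewrite !mxE /= /bump/=.
  by rewrite mulrN1 mulNr.
rewrite !quad_eta big_ord_recl.
set B := \sum_(i < n) (a 0 (lift ord0 i) * w 0 (lift ord0 i)).
set S := \sum_i a 0 _ ^+ 2; set T := \sum_i w 0 _ ^+ 2 => a1.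
set a0 := a 0 0 in a1 *; set w0 := w 0 0.
have S0 : 0 <= S by apply: sumr_ge0 => i _; rewrite sqr_ge0.
have a0sq : a0 ^+ 2 = 1 + S by rewrite -[LHS](subrK S) a1.
have sq : 0 <= a0 ^+ 2 * T + 2 * a0 * w0 * B + w0 ^+ 2 * S.
  rewrite !mulr_sumr -!big_split/= sumr_ge0// => i _.
  rewrite [X in 0 <= X](_ : _ =
    (a0 * w 0 (lift ord0 i) + w0 * a 0 (lift ord0 i)) ^+ 2) ?sqr_ge0//.
  by ring.
have a0_gt0 : 0 < a0 ^+ 2 by rewrite a0sq; lra.
rewrite -subr_ge0 -(pmulr_rge0 _ a0_gt0).
rewrite [X in 0 <= X](_ : _ = (a0 ^+ 2 * T + 2 * a0 * w0 * B + w0 ^+ 2 * S)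
  + (a0 * B + S * w0) ^+ 2); first by rewrite addr_ge0// sqr_ge0.
have -> : S = a0 ^+ 2 - 1 by rewrite a0sq addrAC subrr add0r.
by ring.
Qed.

Section lorentzian.
Context {R : realType} {n : nat}.
Implicit Types (A : 'M[R]_n) (v w : 'rV[R]_n).

Let eta := minkowski_mx R n.

Let eta2 : eta *m eta = 1%:M.
Proof.
rewrite mulmx_diag -diag_const_mx; congr diag_mx; apply/rowP => i.
by rewrite !mxE; case: ifP => _; rewrite ?mulr1 ?mulrNN ?mulr1.
Qed.

Let lorentzianE A : lorentzian A -> exists2 P : 'M[R]_n, P \in unitmx &
  A = invmx P *m eta *m (invmx P)^T.
Proof.
move=> [P Pu PAP]; exists P => //.
by rewrite -[eta]PAP -mulmxA -!mulmxA mulKmx// -trmx_mul mulVmx// trmx1 mulmx1.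
Qed.

Lemma lorentzian_tr A : lorentzian A -> A^T = A.
Proof.
by move=> /lorentzianE[P _ ->]; rewrite !trmx_mul trmxK tr_diag_mx mulmxA.
Qed.

Lemma lorentzian_unitmx A : lorentzian A -> A \in unitmx.
Proof.
move=> /lorentzianE[P Pu ->].
rewrite !unitmx_mul unitmx_tr unitmx_inv Pu andbT/=.
by case: (mulmx1_unit eta2).
Qed.

Let lorentzian_inv A : lorentzian A -> exists2 P : 'M[R]_n, P \in unitmx &
  A = invmx P *m eta *m (invmx P)^T /\ invmx A = P^T *m eta *m P.
Proof.
move=> LA; have /lorentzianE[P Pu EA] := LA; exists P => //; split=> //.
apply: (can_inj (mulKmx (lorentzian_unitmx LA))).
rewrite mulmxV ?lorentzian_unitmx// {1}EA !mulmxA.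
rewrite -(mulmxA _ _ P^T) -trmx_mul mulmxV// trmx1 mulmx1.
by rewrite -(mulmxA (invmx P)) eta2 mulmx1 mulVmx.
Qed.

Lemma lorentzian_trace A : lorentzian A ->
  \sum_i \sum_j invmx A i j * A i j = n%:R.
Proof.
move=> LA; have <- : \tr (invmx A *m A^T) = n%:R.
  by rewrite lorentzian_tr// mulVmx ?lorentzian_unitmx// mxtrace1.
by apply: eq_bigr => i _; rewrite mxE; apply: eq_bigr => j _; rewrite mxE.
Qed.

(** Reverse Cauchy-Schwarz for a covector [w] and a unit timelike vector [v]. In a frame that
    diagonalizes [A] they become [w *m P^T] and [v *m invmx P]; their pairing is unchanged, so the
    Minkowski case applies. *)
Lemma lorentzian_inv_le_sqr A v w : lorentzian A -> quad A v = 1 ->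
  quad (invmx A) w <= (\sum_i v 0 i * w 0 i) ^+ 2.
Proof.
move=> /lorentzian_inv[P Pu [EA ->]]; rewrite EA quadM => /minkowski_le_sqr le1.
rewrite -{2}(trmxK P) quadM (le_trans (le1 _))// le_eqVlt; apply/orP; left.
have pairE (a b : 'rV[R]_n) : \sum_i a 0 i * b 0 i = (a *m b^T) 0 0.
  by rewrite mxE; apply: eq_bigr => i _; rewrite mxE.
by rewrite !pairE trmx_mul trmxK mulmxA mulmxKV.
Qed.

End lorentzian.

(** * Contractions of the Einstein equation and the pointwise curvature bound *)

(** Taken with [W = v^T *m v] and with [W] the inverse metric, so that one computation serves both
    contractions of the Einstein equation. *)
Definition contract (R : realType) n (W B : 'M[R]_n) : R :=
  \sum_i \sum_j W i j * B i j.

Section contract.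
Context {R : realType} {n : nat}.
Implicit Types (W B C : 'M[R]_n).

Lemma contractD W B C : contract W (B + C) = contract W B + contract W C.
Proof.
rewrite /contract -big_split; apply: eq_bigr => i _.
by rewrite -big_split; apply: eq_bigr => j _; rewrite mxE mulrDr.
Qed.

Lemma contractZ W k B : contract W (k *: B) = k * contract W B.
Proof.
rewrite /contract mulr_sumr; apply: eq_bigr => i _.
by rewrite mulr_sumr; apply: eq_bigr => j _; rewrite mxE mulrCA.
Qed.

Lemma contractN W B : contract W (- B) = - contract W B.
Proof. by rewrite -scaleN1r contractZ mulN1r. Qed.

Lemma contract_sqr (v : 'rV[R]_n) B : contract (v^T *m v) B = quad B v.
Proof.
apply: eq_bigr => i _; apply: eq_bigr => j _.
by rewrite !mxE big_ord1 !mxE mulrC mulrA.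
Qed.

End contract.

Section ekg_point.
Context {R : realType} {n : nat}.
Implicit Types (g : 'rV[R]_n -> 'M[R]_n) (u : 'rV[R]_n -> R) (x : 'rV[R]_n).

Definition gradient u x : 'rV[R]_n := \row_i partial i u x.

Definition hessian_mx g u x : 'M[R]_n := \matrix_(i, j) hessian g u i j x.

Lemma contract_einstein W g x : contract W (einstein g x) =
  contract W (ricci g x) - 2^-1 * scalar_curvature g x * contract W (g x).
Proof. by rewrite /einstein contractD contractN contractZ. Qed.

Lemma contract_stress_energy W m xi g u x :
  contract W (stress_energy m xi g u x) =
  contract W ((gradient u x)^T *m gradient u x)
  + 2^-1 * contract W (g x) * (m ^+ 2 * u x ^+ 2 - grad_sq g u x)
  + xi * (contract W (g x) * box g (fun y => u y ^+ 2) x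
          - contract W (hessian_mx g (fun y => u y ^+ 2) x)
          - contract W (einstein g x) * u x ^+ 2).
Proof.
set u2 := fun y => u y ^+ 2.
have -> : stress_energy m xi g u x = (gradient u x)^T *m gradient u x
    + (2^-1 * (m ^+ 2 * u x ^+ 2 - grad_sq g u x)) *: g x
    + xi *: (box g u2 x *: g x - hessian_mx g u2 x - u x ^+ 2 *: einstein g x).
  by apply/matrixP => i j; rewrite !mxE big_ord1 !mxE; ring.
rewrite !(contractD, contractZ, contractN); ring.
Qed.

(** The product rule. Differentiability is assumed near [x] because the formula for the first
    partials of [u^2] is differentiated once more. *)
Lemma hessian_sqr g u x i j :
  (\forall y \near x, differentiable (u : _ -> R^o) y) ->
  differentiable (partial j u : _ -> R^o) x ->
  hessian g (fun y => u y ^+ 2) i j x =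
  2 * u x * hessian g u i j x + 2 * (partial i u x * partial j u x).
Proof.
move=> du ddu.
have dsqr k y : differentiable (u : _ -> R^o) y ->
    partial k (fun y => u y ^+ 2) y = 2 * (u y * partial k u y).
  move=> duy; rewrite /partial (_ : (fun _ => _) = u * u); last first.
    by apply/funext => z; rewrite expr2.
  rewrite (deriveM (diff_derivable duy) (diff_derivable duy)) /GRing.scale/=.
  by ring.
have dux := nbhs_singleton du.
have -> : hessian g (fun y => u y ^+ 2) i j x =
  'D_(delta_mx 0 i) (fun y => 2 *: (u y * partial j u y : R^o) : R^o) x
  - \sum_k christoffel g k i j x * (2 * (u x * partial k u x)).
  rewrite /hessian; congr (_ - _).
    apply: near_eq_derive; near=> y; rewrite dsqr//; near: y; exact: du.
  by apply: eq_bigr => k _; rewrite dsqr.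
rewrite deriveZ ?deriveM//; [|exact: diff_derivable..|]; last first.
  by apply: derivableM; exact: diff_derivable.
rewrite /hessian mulrBr mulr_sumr /GRing.scale/= -!/(partial _ _ _).
rewrite [X in _ - X](eq_bigr (fun k =>
    2 * u x * (christoffel g k i j x * partial k u x))); last first.
  by move=> k _; ring.
by ring.
Unshelve. all: by end_near. Qed.

Lemma box_sqr g u x : (\forall y \near x, differentiable (u : _ -> R^o) y) ->
  (forall j, differentiable (partial j u : _ -> R^o) x) ->
  box g (fun y => u y ^+ 2) x = 2 * u x * box g u x + 2 * grad_sq g u x.
Proof.
move=> du ddu; rewrite /box /grad_sq !mulr_sumr -big_split.
apply: eq_bigr => i _.
rewrite !mulr_sumr -big_split; apply: eq_bigr => j _ /=.
by rewrite hessian_sqr//; ring.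
Qed.

Lemma ekg_timelike_convergence g u x m xi v :
  (2 < n)%N -> 0 <= xi <= conformal_coupling R n ->
  lorentzian (g x) -> quad (g x) v = 1 ->
  (\forall y \near x, differentiable (u : _ -> R^o) y) ->
  (forall j, differentiable (partial j u : _ -> R^o) x) ->
  box g u x + m ^+ 2 * u x + xi * scalar_curvature g x * u x = 0 ->
  einstein g x = - (8 * pi) *: stress_energy m xi g u x ->
  0 < 1 - 8 * pi * xi * u x ^+ 2 ->
  (1 - 8 * pi * xi * u x ^+ 2) * quad (ricci g x) v <=
  8 * pi * ((1 - 2 * xi) / (n%:R - 2) * (m ^+ 2 * u x ^+ 2)
    + 2 * xi * (u x * quad (hessian_mx g u x) v)).
Proof.
move=> n2 /andP[xi0 xic] Lg v1 du ddu field_eq einstein_eq F0.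
pose s := \sum_i v 0 i * gradient u x 0 i.
have contr W := contract_einstein W g x.
have contrT W := contract_stress_energy W m xi g u x.
have trg : contract (metric_inv g x) (g x) = n%:R by exact: lorentzian_trace.
have trR : contract (metric_inv g x) (ricci g x) = scalar_curvature g x by [].
have trdu : contract (metric_inv g x) ((gradient u x)^T *m gradient u x) =
    grad_sq g u x.
  apply: eq_bigr => i _; apply: eq_bigr => j _.
  by rewrite !mxE big_ord1 !mxE mulrA.
have trH : contract (metric_inv g x) (hessian_mx g (fun y => u y ^+ 2) x) =
    box g (fun y => u y ^+ 2) x.
  by apply: eq_bigr => i _; apply: eq_bigr => j _; rewrite mxE.
have vdu : quad ((gradient u x)^T *m gradient u x) v = s ^+ 2.
  rewrite quadE mulmxA -mulmxA -[gradient u x *m _]trmxK trmx_mul trmxK.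
  have -> : v *m (gradient u x)^T = s%:M.
    apply/rowP => i; rewrite !ord1 !mxE mulr1n.
    by apply: eq_bigr => k _; rewrite mxE.
  by rewrite tr_scalar_mx -scalar_mxM mxE.
(* [s] is d u(v), so this is the reverse Cauchy-Schwarz inequality for the unit timelike [v]. *)
have grads : grad_sq g u x <= s ^+ 2.
  apply: le_trans (lorentzian_inv_le_sqr (gradient u x) Lg v1).
  rewrite le_eqVlt; apply/orP; left; apply/eqP.
  by apply: eq_bigr => i _; apply: eq_bigr => j _; rewrite !mxE.
have vH : quad (hessian_mx g (fun y => u y ^+ 2) x) v =
    2 * (u x * quad (hessian_mx g u x) v) + 2 * s ^+ 2.
  have -> : hessian_mx g (fun y => u y ^+ 2) x =
      (2 * u x) *: hessian_mx g u x + 2 *: ((gradient u x)^T *m gradient u x).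
    by apply/matrixP => i j; rewrite !mxE big_ord1 !mxE hessian_sqr.
  by rewrite -!contract_sqr contractD !contractZ !contract_sqr vdu mulrA.
(* The algebraic bound is stated with the Hessian of [u^2], whose extra [2 s^2] cancels
   [- 2 xi s^2]. *)
rewrite [X in _ <= _ * X](_ : _ =
    (1 - 2 * xi) / (n%:R - 2) * (m ^+ 2 * u x ^+ 2) - 2 * xi * s ^+ 2
    + xi * quad (hessian_mx g (fun y => u y ^+ 2) x) v); last first.
  by rewrite vH; ring.
apply: (@ekg_convergence_bound _ _ _ _ _ _ _ (scalar_curvature g x) _
  (grad_sq g u x) _ (box g u x)) => //.
- by rewrite ltr_nat.
- by rewrite mulr_ge0// pi_ge0.
- by rewrite sqr_ge0.
(* Only the first occurrence of the Einstein tensor is replaced: the stress-energy tensor contains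
   it again, and there it must stay. *)
- have := contr (v^T *m v); rewrite !contract_sqr v1 mulr1 => Ev.
  rewrite -Ev {1}einstein_eq -contract_sqr contractZ contrT.
  by rewrite !contract_sqr v1 vdu box_sqr//; ring.
- have := contr (metric_inv g x); rewrite trR trg => Et.
  have -> : scalar_curvature g x - 2^-1 * n%:R * scalar_curvature g x =
    contract (metric_inv g x) (einstein g x) by rewrite Et; ring.
  by rewrite {1}einstein_eq contractZ contrT trdu trg trH box_sqr//; ring.
Qed.

End ekg_point.

(** * Functions of class C^1 near a point of the line *)

(** A condition at a single point, so that a cut-off function can be treated by one argument on the
    support and another off it. *)
Definition C1_near (R : realType) (f : R -> R) (t : R) : Prop :=
  (\forall s \near t, derivable f s 1) /\ {for t, continuous (derive1 f)}.

Section C1_near.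
Context {R : realType}.
Implicit Types (f g : R -> R) (s t : R).

Lemma derivable_continuous f t : derivable f t 1 -> {for t, continuous f}.
Proof.
by move=> df; apply: differentiable_continuous; exact/derivable1_diffP.
Qed.

Lemma is_derive1_derivable f t : derivable f t 1 ->
  is_derive (t : R) 1 f (derive1 f t).
Proof. by move=> df; rewrite derive1E; exact: derivableP. Qed.

Lemma C1_near_derivable f t : C1_near f t -> derivable f t 1.
Proof. by case=> /nbhs_singleton. Qed.

Lemma C1_near_continuous f t : C1_near f t -> {for t, continuous f}.
Proof. by move=> /C1_near_derivable/derivable_continuous. Qed.

Lemma C1_near_is_derive f (df : R -> R) t :
  (\forall s \near t, is_derive (s : R) 1 f (df s)) ->
  {for t, continuous df} -> C1_near f t.
Proof.
move=> fdf cdf; split; first by apply: filterS fdf => s [].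
have fE : \forall s \near t, df s = (derive1 f) s.
  by apply: filterS fdf => s [_ <-]; rewrite derive1E.
have cdf' : df s @[s --> t] --> df t := cdf.
suff H : derive1 f s @[s --> t] --> derive1 f t by exact: H.
rewrite -(nbhs_singleton fE); apply: cvg_trans cdf'; exact: near_eq_cvg.
Qed.

Lemma C1_near_eq f g t : (\forall s \near t, f s = g s) ->
  C1_near f t -> C1_near g t.
Proof.
move=> fg [df cf]; apply: (@C1_near_is_derive _ (derive1 f)) => //.
apply: filterS2 (near_join fg) df => s fgs dfs.
apply: near_eq_is_derive fgs _.
exact: is_derive1_derivable.
Qed.

Lemma C1_near_cst k t : C1_near (cst k) t.
Proof.
apply: (@C1_near_is_derive _ (cst 0)); last exact: cst_continuous.
by near=> s; exact: is_derive_cst.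
Unshelve. all: by end_near. Qed.

Lemma C1_nearM f g t : C1_near f t -> C1_near g t -> C1_near (f * g) t.
Proof.
move=> [df cf] [dg cg].
apply: (@C1_near_is_derive _ (f * (derive1 g) + g * (derive1 f))).
  apply: filterS2 df dg => s dfs dgs.
  exact: is_deriveM (is_derive1_derivable dfs) (is_derive1_derivable dgs).
have cf0 := derivable_continuous (nbhs_singleton df).
have cg0 := derivable_continuous (nbhs_singleton dg).
exact: continuousD (continuousM cf0 cg) (continuousM cg0 cf).
Qed.

Lemma C1_nearD f g t : C1_near f t -> C1_near g t -> C1_near (f + g) t.
Proof.
move=> [df cf] [dg cg].
apply: (@C1_near_is_derive _ (derive1 f + derive1 g)); last first.
  exact: (continuousD cf cg).
apply: filterS2 df dg => s dfs dgs.
exact: is_deriveD (is_derive1_derivable dfs) (is_derive1_derivable dgs).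
Qed.

Lemma C1_near_comp f g t : C1_near f t -> C1_near g (f t) -> C1_near (g \o f) t.
Proof.
move=> [df cf] [dg cg].
have cf0 := derivable_continuous (nbhs_singleton df).
apply: (@C1_near_is_derive _ (((derive1 g) \o f) * (derive1 f))).
  apply: filterS2 df (cf0 _ dg) => s dfs dgs.
  have /derivable1_diffP dfs' := dfs; have /derivable1_diffP dgs' := dgs.
  apply: DeriveDef; first by apply/derivable1_diffP; exact: differentiable_comp.
  by rewrite -derive1E derive1_comp.
exact: continuousM (continuous_comp cf0 cg) cf.
Qed.

Lemma C1_near_inv_sqrt t : 0 < t -> C1_near (fun s => (Num.sqrt s)^-1) t.
Proof.
move=> t0.
apply: (@C1_near_is_derive _
  (fun s => - (Num.sqrt s) ^- 2 * (2 * Num.sqrt s)^-1)).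
  near=> s; have s0 : 0 < s by near: s; exact: lt_nbhsr.
  have ds := is_derive1_sqrt s0.
  have ns : Num.sqrt s != 0 by rewrite gt_eqF// sqrtr_gt0.
  apply: DeriveDef; first by apply: derivableV.
  by rewrite (deriveV ns)// derive_sqrt.
have ct : {for t, continuous (@Num.sqrt R)} by exact: sqrt_continuous.
have nt : Num.sqrt t != 0 by rewrite gt_eqF// sqrtr_gt0.
apply: continuousM.
  apply: continuousN; apply: continuousV; rewrite ?expf_neq0//.
  exact: (continuousM ct ct).
apply: continuousV; first by rewrite mulf_neq0// pnatr_eq0.
by apply: continuousM => //; exact: cst_continuous.
Unshelve. all: by end_near. Qed.

End C1_near.

(** * Integrals of compactly supported functions *)

(* No measurability is required, since the integral is a difference of suprema
   over simple functions. This matters for the Ricci term, which is evaluated in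
   a chart that varies with the parameter. *)
Lemma le_integral_nomeas d (T : measurableType d) (R : realType)
    (mu : {measure set T -> \bar R}) (D : set T) (f g : T -> \bar R) :
  (forall x, D x -> (f x <= g x)%E) ->
  (\int[mu]_(x in D) f x <= \int[mu]_(x in D) g x)%E.
Proof.
move=> fg; have le_patch x : ((f \_ D) x <= (g \_ D) x)%E.
  by rewrite /patch; case: ifPn => // /set_mem /fg.
have le_patchT : {in setT, forall x, ((f \_ D) x <= (g \_ D) x)%E} by [].
rewrite /integral; apply: leeB; apply: le_ereal_sup;
  apply: image_subset => h /= hf x; apply: (le_trans (hf x)).
  by apply: (funepos_le le_patchT); rewrite in_setT.
by apply: (funeneg_le le_patchT); rewrite in_setT.
Qed.

Section compact_support.
Context {R : realType}.
Implicit Types (f : R -> R) (D : set R).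
Local Notation mu := (@lebesgue_measure R).

Let patch_support f D a b : (forall t, ~ (D t /\ t \in `[a, b]) -> f t = 0) ->
  (EFin \o f) \_ D = (EFin \o f) \_ `[a, b].
Proof.
move=> f0; apply/funext => t; rewrite /patch /=.
have [tD|tD] := boolP (t \in D);
  have [tab|tab] := boolP (t \in `[a, b]%classic) => //.
- by rewrite f0// => -[_ abt]; move: tab; rewrite mem_setE abt.
- by rewrite f0// => -[/mem_set]; rewrite (negbTE tD).
Qed.

(** Extended by zero, the two integrands are the same function. *)
Lemma compact_support_integral f D a b :
  (forall t, ~ (D t /\ t \in `[a, b]) -> f t = 0) ->
  (\int[mu]_(t in D) (f t)%:E = \int[mu]_(t in `[a, b]) (f t)%:E)%E.
Proof.
move=> f0; rewrite [LHS]integral_mkcond [RHS]integral_mkcond.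
by congr integral; exact: patch_support.
Qed.

Lemma compact_support_integrable f D a b : measurable D -> continuous f ->
  (forall t, ~ (D t /\ t \in `[a, b]) -> f t = 0) ->
  mu.-integrable D (EFin \o f).
Proof.
move=> mD cf /patch_support fE.
have := continuous_compact_integrable (@segment_compact R a b)
  (continuous_subspaceT cf).
rewrite integrable_mkcond; last exact: measurable_itv.
by rewrite -fE => fD; rewrite integrable_mkcond.
Qed.

(** The integral over [D] is one over [[a, b]], where the fundamental theorem of calculus gives
    [f b - f a]. *)
Lemma compact_support_integral_derive f D a b : a < b ->
  (forall t, C1_near f t) ->
  f a = 0 -> f b = 0 ->
  (forall t, ~ (D t /\ t \in `[a, b]) -> derive1 f t = 0) ->
  (\int[mu]_(t in D) (derive1 f t)%:E = 0)%E.
Proof.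
move=> ab Cf fa fb f'0.
rewrite (compact_support_integral f'0).
rewrite (@continuous_FTC2 _ _ f)//; first by rewrite fa fb sube0.
  by apply: continuous_subspaceT => t; have [] := Cf t.
split; first by move=> t _; exact: C1_near_derivable.
  exact/cvg_at_right_filter/C1_near_continuous.
exact/cvg_at_left_filter/C1_near_continuous.
Qed.

End compact_support.

(** * First and second derivatives of a function along a curve in coordinates *)

Section curve.
Context {R : realType} {n : nat}.
Implicit Types (F u : 'rV[R]_n -> R) (x : R -> 'rV[R]_n) (t : R).

Definition derive_along x F t : R :=
  \sum_i derive1 x t 0 i * partial i F (x t).

Lemma is_derive_along x F t : derivable x t 1 ->
  differentiable (F : _ -> R^o) (x t) ->
  is_derive (t : R) 1 (F \o x) (derive_along x F t).
Proof.
move=> /derivable1_diffP dx dF.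
have dFx : differentiable (F \o x : R -> R^o) t by exact: differentiable_comp.
apply: DeriveDef; first exact: diff_derivable.
rewrite deriveE// (diff_comp dx dF) /= -derive1E'//.
rewrite (row_sum_delta (derive1 x t)) linear_sum; apply: eq_bigr => i _.
by rewrite linearZ /partial deriveE.
Qed.

(** The result of differentiating [derive_along x u] by the product rule: second partials contracted
    twice with the velocity, plus the differential applied to the acceleration. *)
Definition derive2_along x u t : R :=
  \sum_i (derive1 x t 0 i * derive_along x (partial i u) t
          + partial i u (x t) * derive1 (derive1 x) t 0 i).

Variables (x : R -> 'rV[R]_n) (u : 'rV[R]_n -> R).
Variables (U : set R) (W : set 'rV[R]_n).
Hypothesis xUW : forall t, U t -> W (x t).
Hypothesis Cx : @Ck R R^o _ 2 U x.
Hypothesis Cu : @Ck R _ R^o 2 W u.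

Let derive1x : derive1 x = (fun t : R^o => 'D_(1 : R^o) (x : R^o -> _) t).
Proof. by apply/funext => t; rewrite derive1E. Qed.

Let dx t : U t -> derivable x t 1.
Proof. by case: Cx => diffx _ Ut; apply: diff_derivable; exact: diffx. Qed.

Let dv t : U t -> derivable (derive1 x) t 1.
Proof.
case: Cx => _ /(_ 1)[diffv _] Ut; rewrite derive1x.
by apply: diff_derivable; exact: diffv.
Qed.

Let cvx t : U t -> {for t, continuous x}.
Proof.
by case: Cx => diffx _ Ut; exact: differentiable_continuous (diffx _ Ut).
Qed.

Let cvv t i : U t -> {for t, continuous (fun s : R => derive1 x s 0 i : R)}.
Proof.
case: Cx => _ /(_ 1)[diffv _] Ut.
have h : {for t, continuous (derive1 x)}.
  rewrite derive1x; exact: differentiable_continuous (diffv _ Ut).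
exact: continuous_comp h (@coord_continuous _ _ _ _ _ _).
Qed.

Let cva t i : U t ->
  {for t, continuous (fun s : R => derive1 (derive1 x) s 0 i : R)}.
Proof.
case: Cx => _ /(_ 1)[_ /(_ 1) ca] Ut.
have h : {for t, continuous (derive1 (derive1 x))}.
  rewrite [X in derive1 X]derive1x (_ : derive1 _ = fun s : R^o => 
    'D_(1 : R^o) (fun t : R^o => 'D_(1 : R^o) (x : R^o -> _) t) s).
    by apply: ca; rewrite inE.
  by apply/funext => s; rewrite derive1E.
exact: continuous_comp h (@coord_continuous _ _ _ _ _ _).
Qed.

Let du y : W y -> differentiable (u : _ -> R^o) y.
Proof. by case: Cu => diffu _; exact: diffu. Qed.

Let ddu i y : W y -> differentiable (partial i u : _ -> R^o) y.
Proof. by case: Cu => _ /(_ (delta_mx 0 i))[diffu _]; exact: diffu. Qed.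

Let cddu i j y : W y -> {for y, continuous (partial j (partial i u))}.
Proof.
case: Cu => _ /(_ (delta_mx 0 i))[_ /(_ (delta_mx 0 j)) c] Wy.
by apply: c; rewrite inE.
Qed.

Lemma is_derive1_curve t : U t ->
  is_derive (t : R) 1 (u \o x) (derive_along x u t).
Proof. by move=> Ut; apply: is_derive_along; [exact: dx|exact/du/xUW]. Qed.

Lemma is_derive2_curve t : U t ->
  is_derive (t : R) 1 (derive_along x u) (derive2_along x u t).
Proof.
move=> Ut.
pose h (i : 'I_n) := (fun s => derive1 x s 0 i : R) * (partial i u \o x).
have -> : derive_along x u = \sum_i h i.
  by apply/funext => s; rewrite fct_sumE; apply: eq_bigr.
apply: is_derive_sum => i.
have := dv Ut; rewrite derivable_mxP => /(_ 0 i) dvi.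
have dvE : is_derive (t : R) 1 (fun s => derive1 x s 0 i : R)
    (derive1 (derive1 x) t 0 i).
  by apply: DeriveDef => //; rewrite derive1E (derive_mx (dv Ut)) mxE.
have duE := is_derive_along (dx Ut) (ddu i (xUW Ut)).
exact: is_deriveM dvE duE.
Qed.

Lemma continuous_derive2_curve t : U t ->
  {for t, continuous (derive2_along x u)}.
Proof.
move=> Ut; have Wx := xUW Ut.
have sumc (h : 'I_n -> R -> R) : (forall i, {for t, continuous (h i)}) ->
    {for t, continuous (fun s => \sum_i h i s)}.
  move=> hc.
  have addc : continuous (fun z : R * R => z.1 + z.2) by exact: add_continuous.
  have := @cvg_big R _ _ 0 xpredT addc R (nbhs t) (index_enum 'I_n) h (h^~ t) _.
  by apply => i _; exact: hc.
have mulc (a b : R -> R) : {for t, continuous a} -> {for t, continuous b} ->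
    {for t, continuous (fun s => a s * b s)} by exact: continuousM.
have addc (a b : R -> R) : {for t, continuous a} -> {for t, continuous b} ->
    {for t, continuous (fun s => a s + b s)} by exact: continuousD.
apply: (sumc) => i.
have cpu : {for t, continuous (fun s => partial i u (x s))}.
  exact: continuous_comp (cvx Ut) (differentiable_continuous (ddu i Wx)).
have cd : {for t, continuous (derive_along x (partial i u))}.
  apply: sumc => j.
  have cpp : {for t, continuous (fun s => partial j (partial i u) (x s))}.
    exact: continuous_comp (cvx Ut) (@cddu i j _ Wx).
  exact: (mulc _ _ (cvv Ut) cpp).
exact: (addc _ _ (mulc _ _ (cvv Ut) cd) (mulc _ _ cpu (cva Ut))).
Qed.

(** The function [q] agrees with [u \o x] only on [U], in the application the times spent in one
    chart; since [U] is open, this determines both derivatives. *)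
Lemma C1_curve (q : R -> R) t : open U -> U t ->
  (forall s, U s -> q s = u (x s)) ->
  [/\ C1_near q t, C1_near (derive1 q) t,
      derive1 q t = derive_along x u t &
      derive1 (derive1 q) t = derive2_along x u t].
Proof.
move=> oU Ut qE; have nU := open_nbhs_nbhs (conj oU Ut).
have q1 s : U s -> is_derive (s : R) 1 q (derive_along x u s).
  move=> Us; apply: near_eq_is_derive (is_derive1_curve Us).
  by apply: filterS (open_nbhs_nbhs (conj oU Us)) => r /qE ->.
have q1E s : U s -> derive1 q s = derive_along x u s.
  by move=> /q1[_ <-]; rewrite derive1E.
have q2 s : U s -> is_derive (s : R) 1 (derive1 q) (derive2_along x u s).
  move=> Us; apply: near_eq_is_derive (is_derive2_curve Us).
  by apply: filterS (open_nbhs_nbhs (conj oU Us)) => r /q1E ->.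
split; [|apply: (@C1_near_is_derive _ _ (derive2_along x u))|exact: q1E|].
- apply: (@C1_near_is_derive _ _ (derive_along x u)).
    by apply: filterS nU; exact: q1.
  by apply: derivable_continuous; have [] := is_derive2_curve Ut.
- by apply: filterS nU; exact: q2.
- exact: continuous_derive2_curve.
- by have [_ <-] := q2 t Ut; rewrite derive1E.
Qed.

End curve.

(** The geodesic equation turns the acceleration term into the Christoffel term of the Hessian. *)
Lemma derive2_along_geodesic (R : realType) n (g : 'rV[R]_n -> 'M[R]_n)
    (x : R -> 'rV[R]_n) (u : 'rV[R]_n -> R) t :
  (forall l, derive1 (derive1 x) t 0 l
    + \sum_i \sum_j christoffel g l i j (x t)
        * derive1 x t 0 i * derive1 x t 0 j = 0) ->
  derive2_along x u t = quad (hessian_mx g u (x t)) (derive1 x t).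
Proof.
set v := derive1 x t => geo; rewrite /derive2_along big_split/=.
rewrite -/v.
have -> : quad (hessian_mx g u (x t)) v =
  \sum_i v 0 i * derive_along x (partial i u) t
  - \sum_l partial l u (x t)
    * (\sum_i \sum_j christoffel g l i j (x t) * v 0 i * v 0 j).
  transitivity (\sum_i \sum_j (partial i (partial j u) (x t) * v 0 i * v 0 j
      - \sum_l partial l u (x t)
          * (christoffel g l i j (x t) * v 0 i * v 0 j))).
    apply: eq_bigr => i _; apply: eq_bigr => j _.
    rewrite mxE /hessian !mulrBl !mulr_suml; congr (_ - _).
    by apply: eq_bigr => l _; ring.
  under eq_bigr do rewrite big_split/= sumrN.
  rewrite big_split/= sumrN; congr (_ - _).
    rewrite exchange_big; apply: eq_bigr => i _; rewrite mulr_sumr.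
    by apply: eq_bigr => j _; rewrite -/v; ring.
  under [RHS]eq_bigr do rewrite mulr_sumr.
  rewrite [RHS]exchange_big; apply: eq_bigr => i _.
  under [RHS]eq_bigr do rewrite mulr_sumr.
  by rewrite [RHS]exchange_big.
rewrite -sumrN; congr +%R; apply: eq_bigr => l _.
by rewrite -mulrN; congr (_ * _); apply/eqP; rewrite -addr_eq0 geo.
Qed.

(** * From the pointwise bound to the weighted integral *)

Section integrated_bound.
Context {R : realType}.
Local Notation mu := (@lebesgue_measure R).
Variables (k xi A m : R) (I : set R) (q f Rv : R -> R).
Hypothesis k0 : 0 <= k.
Hypothesis xi0 : 0 <= xi.
Hypothesis oI : open I.
Hypothesis Cq : forall t, I t -> C1_near q t.
Hypothesis Cdq : forall t, I t -> C1_near (derive1 q) t.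
Hypothesis Cf : forall t, C1_near f t.
Let K := closure [set t | f t != 0].
Hypothesis cK : compact K.
Hypothesis KI : K `<=` I.
Let F t : R := 1 - k * xi * q t ^+ 2.
Hypothesis F0 : forall t, 0 < F t.
Hypothesis RvF : forall t, I t -> F t * Rv t <=
  k * (A * (m ^+ 2 * q t ^+ 2) + 2 * xi * (q t * derive1 (derive1 q) t)).

Let h t : R := f t / Num.sqrt (F t).
(** The total derivative to be added: [(h^2 q q')'] contains the term [h^2 q q''], and its integral
    vanishes. *)
Let psi : R -> R := cst (2 * xi * k) * (h * h * (q * derive1 q)).
Let bound t : R :=
  (A * (m ^+ 2 * f t ^+ 2 / F t) + 2 * xi * (derive1 h t) ^+ 2)
  * (k * q t ^+ 2).

Let h2 t : h t ^+ 2 = f t ^+ 2 / F t.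
Proof. by rewrite /h expr_div_n sqr_sqrtr// ltW. Qed.

Let Ch t : I t -> C1_near h t.
Proof.
move=> It.
have CF : C1_near F t.
  have -> : F = cst 1 + cst (- (k * xi)) * (q * q).
    by apply/funext => s; rewrite /F !fctE; ring.
  exact: C1_nearD (C1_near_cst 1 t) (C1_nearM (C1_near_cst (- (k * xi)) t)
    (C1_nearM (Cq It) (Cq It))).
exact: C1_nearM (Cf t) (C1_near_comp CF (C1_near_inv_sqrt (F0 t))).
Qed.

Let f0 t : ~ K t -> f t = 0.
Proof.
by move=> Kt; apply: contrapT => /eqP ft; apply: Kt; exact: subset_closure.
Qed.

Let h0 t : ~ K t -> h t = 0.
Proof. by move=> /f0 ft; rewrite /h ft mul0r. Qed.

Let notK t : ~ K t -> \forall s \near t, ~ K s.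
Proof.
move=> Kt; apply: open_nbhs_nbhs; split => //.
exact/closed_openC/closed_closure.
Qed.

Let derive_h0 t : ~ K t -> derive1 h t = 0.
Proof.
move=> Kt; rewrite derive1E (@near_eq_derive _ _ _ _ (cst 0)) ?derive_cst//.
by apply: filterS (notK Kt) => s /h0.
Qed.

Let psi0 t : ~ K t -> psi t = 0.
Proof. by move=> /h0 ht; rewrite /psi !fctE ht !mul0r mulr0. Qed.

Let derive_psi0 t : ~ K t -> derive1 psi t = 0.
Proof.
move=> Kt; rewrite derive1E (@near_eq_derive _ _ _ _ (cst 0)) ?derive_cst//.
by apply: filterS (notK Kt) => s /psi0.
Qed.

Let bound0 t : ~ K t -> bound t = 0.
Proof.
move=> Kt; rewrite /bound f0// derive_h0//.
by rewrite expr0n/= mulr0 mul0r !mulr0 addr0 mul0r.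
Qed.

(** On [K], which lies in [I], the factors are C^1; off the closed set [K], [psi] vanishes in a
    neighbourhood. Hence regularity of [q] on [I] gives regularity of [psi] on the whole line. *)
Let Cpsi t : C1_near psi t.
Proof.
have [Kt|Kt] := pselect (K t).
  have It := KI Kt; apply: C1_nearM (C1_near_cst _ t) _.
  exact: C1_nearM (C1_nearM (Ch It) (Ch It)) (C1_nearM (Cq It) (Cdq It)).
apply: (@C1_near_eq _ (cst 0)); last exact: C1_near_cst.
by apply: filterS (notK Kt) => s /psi0.
Qed.

Let cbound : continuous bound.
Proof.
move=> t; have [Kt|Kt] := pselect (K t); last first.
  by apply: (@near_cst_continuous _ _ 0); exact: filterS (notK Kt).
(* With [h^2] in place of [f^2 / F], continuity follows from that of [h], [h'] and [q]. *)
have -> : bound = fun t => (A * (m ^+ 2 * (h t * h t))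
    + 2 * xi * (derive1 h t * derive1 h t)) * (k * (q t * q t)).
  by apply/funext => s; rewrite /bound -(mulrA (m ^+ 2)) -h2; ring.
have mulc (a b : R -> R) : {for t, continuous a} -> {for t, continuous b} ->
    {for t, continuous (fun s => a s * b s)} by exact: continuousM.
have addc (a b : R -> R) : {for t, continuous a} -> {for t, continuous b} ->
    {for t, continuous (fun s => a s + b s)} by exact: continuousD.
have cstc (c : R) : {for t, continuous (fun=> c : R)} by exact: cst_continuous.
have It := KI Kt; have ch := C1_near_continuous (Ch It).
have cq := C1_near_continuous (Cq It); have [_ cdh] := Ch It.
exact: (mulc _ _ (addc _ _
    (mulc _ _ (cstc A) (mulc _ _ (cstc _) (mulc _ _ ch ch)))
    (mulc _ _ (cstc _) (mulc _ _ cdh cdh)))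
  (mulc _ _ (cstc k) (mulc _ _ cq cq))).
Qed.

Let derive_psi t : I t -> derive1 psi t = 2 * xi * k *
  (2 * h t * derive1 h t * q t * derive1 q t + h t ^+ 2 * derive1 q t ^+ 2
   + h t ^+ 2 * (q t * derive1 (derive1 q) t)).
Proof.
move=> It.
have dh := is_derive1_derivable (C1_near_derivable (Ch It)).
have dq := is_derive1_derivable (C1_near_derivable (Cq It)).
have ddq := is_derive1_derivable (C1_near_derivable (Cdq It)).
have dc := is_derive_cst (2 * xi * k : R^o) t (1 : R).
have [_] := is_deriveM dc (is_deriveM (is_deriveM dh dh) (is_deriveM dq ddq)).
rewrite -derive1E => ->; rewrite /GRing.scale/=.
by rewrite !fctE; ring.
Qed.

Let pointwise t : I t -> Rv t * f t ^+ 2 <= bound t + derive1 psi t.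
Proof.
move=> It; rewrite derive_psi//.
have -> : Rv t * f t ^+ 2 = F t * Rv t * h t ^+ 2.
  by rewrite h2; field; rewrite gt_eqF.
apply: le_trans (ler_wpM2r (sqr_ge0 _) (RvF It)) _.
rewrite /bound -(mulrA (m ^+ 2)) -h2 -subr_ge0.
(* The two sides differ by [2 xi k ((h q)')^2]. *)
rewrite [X in 0 <= X](_ : _ = 2 * xi * k *
  (derive1 h t * q t + h t * derive1 q t) ^+ 2); last by ring.
by rewrite mulr_ge0 ?sqr_ge0// mulr_ge0// mulr_ge0.
Qed.

Lemma weighted_integral_le :
  (\int[mu]_(t in I) (Rv t * f t ^+ 2)%:E <= \int[mu]_(t in I) (bound t)%:E)%E.
Proof.
have mI : measurable I by exact: open_measurable.
(* [compact_bounded] bounds [K] by every number above its witness, hence [M + 1]. Below, the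
   interval has radius [|M| + 1]: it has positive length whatever the sign of [M], and its endpoints
   lie off [K], where [psi] vanishes. *)
have [M KM] : exists M, forall t, K t -> `|t| <= M.
  have [M [_ KM]] := compact_bounded cK.
  by exists (M + 1); apply: KM; rewrite ltrDl.
have K_itv t : ~ (I t /\ t \in `[- (`|M| + 1), `|M| + 1]) -> ~ K t.
  move=> nIt Kt; apply: nIt; split; first exact: KI.
  have := KM _ Kt; rewrite in_itv/= -ler_norml => /le_trans; apply.
  by rewrite (le_trans (ler_norm _))// lerDl.
have nK e : `|M| < `|e| -> ~ K e.
  by move=> Me /KM eM; move: Me; rewrite ltNge (le_trans eM)// ler_norm.
pose dpsi : R -> R := derive1 psi.
apply: (@le_trans _ _ (\int[mu]_(t in I) (bound t + dpsi t)%:E)%E).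
  by apply: le_integral_nomeas => t It; rewrite lee_fin pointwise.
have ibound : mu.-integrable I (EFin \o bound).
  by apply: (compact_support_integrable mI cbound) => t /K_itv/bound0.
have cdpsi : continuous dpsi.
  by move=> t; have [] := Cpsi t.
have ipsi : mu.-integrable I (EFin \o dpsi).
  by apply: (compact_support_integrable mI cdpsi) => t /K_itv/derive_psi0.
under eq_integral do rewrite EFinD.
rewrite integralD//.
have -> : (\int[mu]_(t in I) (dpsi t)%:E = 0)%E; last by rewrite adde0.
have M1 : 0 < `|M| + 1 by rewrite ltr_wpDl.
apply: (@compact_support_integral_derive _ psi I (- (`|M| + 1)) (`|M| + 1)
  _ Cpsi).
- by rewrite gtrN.
- by apply/psi0/nK; rewrite normrN (gtr0_norm M1) ltrDl.
- by apply/psi0/nK; rewrite (gtr0_norm M1) ltrDl.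
- by move=> t /K_itv/derive_psi0.
Qed.

End integrated_bound.

(** * The field and the curvature along a geodesic of the manifold *)

Section geodesic.
Context {R : realType} {n : nat} {M : topologicalType}.
Context {A : smooth_manifold R n M}.
Variables (g : lorentz_metric A) (phi : M -> R) (m xi : R).
Variables (I : set R) (gamma : R -> M).
Hypothesis sol : ekg_solution m xi g phi.
Hypothesis oI : open I.
Hypothesis geo : timelike_geodesic g I gamma.

Let chart_times_open (c : chart R n M) :
  open [set t : R | I t /\ chart_dom c (gamma t)].
Proof.
rewrite openE => t [It ct]; apply: filterI; first exact: open_nbhs_nbhs.
have gt : {for t, continuous gamma}.
  by apply: (geodesic_continuous geo); rewrite inE.
by apply: gt; apply: open_nbhs_nbhs; split => //; exact: chart_dom_open.
Qed.

(** The chart at [gamma t] is kept fixed; by continuity the geodesic stays in it for an open set of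
    times around [t], which suffices for derivatives at [t]. *)
Lemma C1_field_along_geodesic t : I t ->
  let c := chart_at A (gamma t) in
  let x := Defs.coord c \o gamma in
  [/\ C1_near (phi \o gamma) t, C1_near (derive1 (phi \o gamma)) t &
    derive1 (derive1 (phi \o gamma)) t =
      quad (hessian_mx (g c) (phi \o coord_inv c) (x t)) (velocity c gamma t)].
Proof.
move=> It c x; have Ac : atlas A c := chart_at_atlas A (gamma t).
have ct : chart_dom c (gamma t) := chart_at_dom A (gamma t).
have xUW s : I s /\ chart_dom c (gamma s) -> chart_img c (x s).
  by move=> [_ cs]; exists (gamma s).
have qE s : I s /\ chart_dom c (gamma s) ->
    (phi \o gamma) s = (phi \o coord_inv c) (x s).
  by move=> [_ cs]; rewrite /= coordK.
have [Cq Cdq _ ddq] := C1_curve xUW (geodesic_smooth geo Ac 2)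
  (ekg_smooth sol Ac 2) (@chart_times_open c)
  (conj It ct) qE.
split => //; rewrite ddq; apply: derive2_along_geodesic => l.
exact: geodesic_eq geo _ Ac _ It ct l.
Qed.

Hypothesis n2 : (2 < n)%N.
Hypothesis xi_itv : 0 <= xi <= conformal_coupling R n.
Hypothesis phi_bound : forall p, 0 < 1 - 8 * pi * xi * phi p ^+ 2.

(** At a fixed time the Ricci term and the second derivative of the field are expressed in the same
    chart, where the pointwise bound applies. *)
Lemma ricci_along_le t : I t ->
  (1 - 8 * pi * xi * phi (gamma t) ^+ 2) * ricci_along g gamma t <=
  8 * pi * ((1 - 2 * xi) / (n%:R - 2) * (m ^+ 2 * phi (gamma t) ^+ 2)
    + 2 * xi * (phi (gamma t) * derive1 (derive1 (phi \o gamma)) t)).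
Proof.
move=> It; have [_ _ ->] := C1_field_along_geodesic It.
rewrite /ricci_along; set c := chart_at A (gamma t).
set x := Defs.coord c (gamma t).
have Ac : atlas A c := chart_at_atlas A (gamma t).
have ct : chart_dom c (gamma t) := chart_at_dom A (gamma t).
have cx : chart_img c x by exists (gamma t).
set u := phi \o coord_inv c.
have ux : phi (gamma t) = u x by rewrite /u /x /= coordK.
have [du ddu] := ekg_smooth sol Ac 2.
have := phi_bound (gamma t); rewrite ux; apply: ekg_timelike_convergence => //.
- exact: metric_lorentzian.
- exact: geodesic_unit geo _ Ac _ It ct.
- have nx : nbhs x (chart_img c).
    by apply: open_nbhs_nbhs; split => //; exact: chart_img_open.
  by apply: filterS nx => y; exact: du.
- by move=> j; have [+ _] := ddu (delta_mx 0 j); apply.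
- exact: ekg_field_eq sol _ Ac _ cx.
- exact: ekg_einstein_eq sol _ Ac _ cx.
Qed.

End geodesic.

(** * The integral inequality on the spacetime *)

Lemma Ck2_C1_near (R : realType) (f : R -> R) t :
  Ck 2 [set: R^o] (f : R^o -> R^o) -> C1_near f t.
Proof.
move=> [df /(_ 1)[ddf _]]; apply: (@C1_near_is_derive _ _ (fun s => 'D_1 f s)).
  by near=> s; apply: derivableP; apply: diff_derivable; exact: df.
exact: differentiable_continuous (ddf _ I).
Unshelve. all: by end_near. Qed.

Theorem theorem3 (R : realType) (n : nat) (M : topologicalType)
    (A : smooth_manifold R n M) (g : lorentz_metric A) (phi : M -> R)
    (m xi : R) (I : set R) (gamma : R -> M) (f : R -> R) :
  (2 < n)%N ->
  0 <= m ->
  0 <= xi <= conformal_coupling R n ->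
  ekg_solution m xi g phi ->
  (0 < xi -> forall p : M, `|phi p| < (Num.sqrt (8 * pi * xi))^-1) ->
  open I -> is_interval I ->
  timelike_geodesic g I gamma ->
  Ck 2 [set: R^o] (f : R^o -> R^o) ->
  compact (closure [set t | f t != 0]) ->
  closure [set t | f t != 0] `<=` I ->
  let F := fun t : R => 1 - 8 * pi * xi * phi (gamma t) ^+ 2 in
  (\int[@lebesgue_measure R]_(t in I) (ricci_along g gamma t * f t ^+ 2)%:E
   <= \int[@lebesgue_measure R]_(t in I)
        (((1 - 2 * xi) / (n%:R - 2) * (m ^+ 2 * f t ^+ 2 / F t)
          + 2 * xi * (derive1 (fun s : R => f s / Num.sqrt (F s)) t) ^+ 2)
         * (8 * pi * phi (gamma t) ^+ 2))%:E)%E.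
Proof.
move=> n2 _ xi_itv sol phi_small oI _ geo Cf cf fI; cbv zeta.
have /andP[xi0 _] := xi_itv.
have pi8 : 0 < 8 * pi :> R by rewrite mulr_gt0// pi_gt0.
(* For [xi = 0] the expression is 1; otherwise [|phi| sqrt (8 pi xi) < 1] is squared. *)
have phi_bound p : 0 < 1 - 8 * pi * xi * phi p ^+ 2.
  move: xi0; rewrite le_eqVlt => /predU1P[<-|xi_gt0].
    by rewrite mulr0 mul0r subr0.
  have k0 : 0 < 8 * pi * xi by rewrite mulr_gt0.
  have := phi_small xi_gt0 p.
  rewrite -[X in _ < X]mul1r ltr_pdivlMr ?sqrtr_gt0// => lt1.
  rewrite subr_gt0 -(sqr_sqrtr (ltW k0)) -exprMn -(real_normK (num_real _)).
  by rewrite normrM (ger0_norm (sqrtr_ge0 _)) mulrC expr_lt1// mulr_ge0.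
(* Unification takes [k = 8 pi], [A = (1 - 2 xi) / (n - 2)] and [ricci_along g gamma] for [Rv]. *)
apply: (weighted_integral_le (q := phi \o gamma)) => //.
- exact: ltW.
- by move=> t It; have [] := C1_field_along_geodesic sol oI geo It.
- by move=> t It; have [] := C1_field_along_geodesic sol oI geo It.
- by move=> t; exact: Ck2_C1_near.
- by move=> t; exact: phi_bound.
- by move=> t; exact: (ricci_along_le sol oI geo n2 xi_itv phi_bound).
Qed.
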